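(* Let $\Lambda\subset\mathbb{N}$ be a finite saturated set. Then $\Phi_\Lambda(x^n)$ is a strong divisibility sequence of polynomials if and only if $\Lambda=\langle N\rangle$ for some $N\geq 1$.
   Context: $\mathbb{N}$ denotes the positive integers. A set $\Lambda\subset\mathbb{N}$ is saturated if $d\mid h$ and $h\in\Lambda$ imply $d\in\Lambda$. $\langle N\rangle$ denotes the set of all positive divisors of the positive integer $N$. $\Phi_d(x)$ is the $d$-th cyclotomic polynomial and $\Phi_\Lambda(x):=\prod_{d\in\Lambda}\Phi_d(x)$. A sequence of polynomials $f_n(x)$, $n\geq1$ (here $f_n(x)=\Phi_\Lambda(x^n)$), is a strong divisibility sequence if $\gcd(f_m,f_n)=f_{\gcd(m,n)}$ for all positive integers $m,n$.
   Formalization: The set Λ is assumed nonempty: the empty set is vacuously saturated and gives the constant sequence 1, which is a strong divisibility sequence, but the empty set is not ⟨N⟩ for any N ≥ 1. *)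

(* Defs.v *)
From HB Require Import structures.
From mathcomp Require Import all_boot all_order all_algebra all_field.
From mathcomp Require Import finmap.

Set Implicit Arguments.
Unset Strict Implicit.
Unset Printing Implicit Defensive.

Import GRing.Theory.
Local Open Scope fset_scope.
Local Open Scope ring_scope.

(* Subsets of the positive integers are sets of nat together with this
   hypothesis. *)
Definition positive_set (L : {fset nat}) : Prop :=
  forall d : nat, d \in L -> (0 < d)%N.

Definition saturated (L : {fset nat}) : Prop :=
  forall d h : nat, (d %| h)%N -> h \in L -> d \in L.

Definition divisor_set (N : nat) : {fset nat} := [fset d in divisors N].

(* Cyclotomic polynomials live in Z[x] in the library. They are taken in Q[x],
   where gcdp is the gcd; all the polynomials concerned are monic with integer
   coefficients, so their gcds in Z[x] and in Q[x] agree. *)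
Definition PhiQ (d : nat) : {poly rat} := map_poly intr 'Phi_d.

Definition Phi_set (L : {fset nat}) : {poly rat} := \prod_(d <- L) PhiQ d.

(* Gcds of polynomials are determined up to a unit: %= is equality up to a
   nonzero constant factor. *)
Definition strong_divisibility (F : fieldType) (f : nat -> {poly F}) : Prop :=
  forall m n : nat, (0 < m)%N -> (0 < n)%N ->
    gcdp (f m) (f n) %= f (gcdn m n).

(* Main.v *)
(* The polynomial [Phi_L(x^n)] vanishes at a primitive d-th root of unity iff
   [d / gcd(d, n)] lies in [L]. For [a], [b] in [L] and [d = lcm(a, b)], a
   primitive d-th root of unity is therefore a common root of [Phi_L(x^(d/a))]
   and [Phi_L(x^(d/b))]; as [gcd(d/a, d/b) = 1], strong divisibility makes it a
   root of [Phi_L(x)], so [d] is in [L]. A saturated set closed under lcm is the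
   set of divisors of the lcm of its elements. Conversely
   [Phi_<N>(x^n) = x^(N n) - 1], and
   [gcd(x^a - 1, x^b - 1) = x^gcd(a, b) - 1]. *)
Require Import Defs.
From HB Require Import structures.
From mathcomp Require Import all_boot all_order all_algebra all_field.
From mathcomp Require Import finmap.

Set Implicit Arguments.
Unset Strict Implicit.
Unset Printing Implicit Defensive.

Import GRing.Theory.
Local Open Scope fset_scope.
Local Open Scope ring_scope.

Lemma dvdp_Xn_sub_1 (F : fieldType) (a b : nat) :
  (a %| b)%N -> ('X^a - 1 : {poly F}) %| 'X^b - 1.
Proof. by case/dvdnP=> k ->; rewrite mulnC exprM (subrX1 'X^a) dvdp_mulr. Qed.

(** Bezout in the exponents: if [u a = v b + c] with [c = gcd(a, b)], then [X^c - 1 = (X^(u a) - 1)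
    - X^c (X^(v b) - 1)], so every common divisor of [X^a - 1] and [X^b - 1] divides [X^c - 1]. *)
Lemma gcdp_Xn_sub_1 (F : fieldType) (a b : nat) : (0 < a)%N ->
  gcdp ('X^a - 1 : {poly F}) ('X^b - 1) %= 'X^(gcdn a b) - 1.
Proof.
move=> a_gt0; apply/andP; split; last first.
  by rewrite dvdp_gcd !dvdp_Xn_sub_1 ?dvdn_gcdl ?dvdn_gcdr.
set g := gcdp _ _; case: (egcdnP b a_gt0) => u v Duv _.
have g_dv_a : g %| 'X^(u * a) - 1.
  by rewrite (dvdp_trans (dvdp_gcdl _ _)) ?dvdp_Xn_sub_1 ?dvdn_mull.
have g_dv_b : g %| 'X^(v * b) - 1.
  by rewrite (dvdp_trans (dvdp_gcdr _ _)) ?dvdp_Xn_sub_1 ?dvdn_mull.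
have -> : 'X^(gcdn a b) - 1 =
    'X^(u * a) - 1 - 'X^(gcdn a b) * ('X^(v * b) - 1) :> {poly F}.
  by rewrite mulrBr mulr1 -exprD Duv addnC opprB [RHS]addrC addrA subrK.
by rewrite dvdp_sub ?dvdp_mull.
Qed.

Lemma Phi_divisor_set (N : nat) : (0 < N)%N ->
  Phi_set (divisor_set N) = 'X^N - 1.
Proof.
move=> N_gt0; rewrite /Phi_set.
have pDN : perm_eq (divisor_set N) (divisors N).
  apply: uniq_perm; rewrite ?fset_uniq ?divisors_uniq // => d.
  by rewrite !inE.
rewrite (perm_big _ pDN) /= /PhiQ -rmorph_prod prod_Cyclotomic //.
by rewrite rmorphB rmorph1 /= map_polyXn.
Qed.

Lemma root_PhiQ (d : nat) (z : algC) : (0 < d)%N ->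
  root (map_poly ratr (PhiQ d)) z = d.-primitive_root z.
Proof.
move=> d_gt0; have [w prim_w] := C_prim_root_exists d_gt0.
rewrite /PhiQ -map_poly_comp.
rewrite (@eq_map_poly _ _ _ (intr : int -> algC)); last first.
  by move=> c; rewrite /= rmorph_int.
by rewrite (Cintr_Cyclotomic prim_w) root_cyclotomic.
Qed.

Lemma root_Phi_set (L : {fset nat}) (d : nat) (z : algC) :
  positive_set L -> d.-primitive_root z ->
  root (map_poly ratr (Phi_set L)) z = (d \in L).
Proof.
move=> L_pos prim_z.
rewrite /Phi_set rmorph_prod rootE horner_prod prodf_seq_eq0 /=.
apply/hasP/idP => [[e Le] | Ld]; last first.
  by exists d; rewrite // -rootE root_PhiQ ?L_pos.
rewrite -rootE root_PhiQ ?L_pos // => prim_e.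
(* The order of a root of unity is unique: [d] and [e] divide each other. *)
have -> // : d = e.
  apply/eqP; rewrite eqn_dvd (prim_order_dvd prim_z) (prim_order_dvd prim_e).
  by rewrite !prim_expr_order ?eqxx.
Qed.

(** Assuming the order of [z ^+ n] rather than that of [z] avoids computing the quotient of the
    order of [z] by its gcd with [n]. *)
Lemma root_Phi_set_comp (L : {fset nat}) (n d : nat) (z : algC) :
  positive_set L -> d.-primitive_root (z ^+ n) ->
  root (map_poly ratr (Phi_set L \Po 'X^n)) z = (d \in L).
Proof.
move=> L_pos prim_z; rewrite -(root_Phi_set L_pos prim_z).
by rewrite map_comp_poly map_polyXn rootE horner_comp hornerXn.
Qed.

Lemma strong_divisibility_lcm (L : {fset nat}) (a b : nat) :
    positive_set L ->
    strong_divisibility (fun n : nat => Phi_set L \Po 'X^n) ->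
  a \in L -> b \in L -> lcmn a b \in L.
Proof.
move=> L_pos sdL La Lb; set d := lcmn a b.
have [a_gt0 b_gt0] := (L_pos _ La, L_pos _ Lb).
have d_gt0 : (0 < d)%N by rewrite lcmn_gt0 a_gt0.
have [a_dv_d b_dv_d] : (a %| d)%N /\ (b %| d)%N.
  by rewrite dvdn_lcml dvdn_lcmr.
have da_gt0 : (0 < d %/ a)%N by rewrite divn_gt0 // dvdn_leq.
have db_gt0 : (0 < d %/ b)%N by rewrite divn_gt0 // dvdn_leq.
have co_ab : gcdn (d %/ a) (d %/ b) = 1%N.
  (* Both [a] and [b] divide [d %/ g], hence so does their lcm [d], which forces [g = 1]. *)
  set g := gcdn _ _.
  have g_gt0 : (0 < g)%N by rewrite gcdn_gt0 da_gt0.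
  have g_dv_da : (g %| d %/ a)%N := dvdn_gcdl _ _.
  have g_dv_db : (g %| d %/ b)%N := dvdn_gcdr _ _.
  have g_dv_d : (g %| d)%N := dvdn_trans g_dv_da (dvdn_div a_dv_d).
  have dv_dg e : (e %| d)%N -> (g %| d %/ e)%N -> (e %| d %/ g)%N.
    by move=> e_dv_d; rewrite (dvdn_divRL _ e_dv_d) (dvdn_divRL _ g_dv_d) mulnC.
  have : (d %| d %/ g)%N by rewrite {1}/d dvdn_lcm !dv_dg.
  rewrite (dvdn_divRL _ g_dv_d) -[X in (_ %| X)%N]muln1 dvdn_pmul2l // dvdn1.
  by move/eqP.
have [z prim_z] := C_prim_root_exists d_gt0.
have := sdL _ _ da_gt0 db_gt0; rewrite co_ab.
(* Gcds are preserved by field extension, so the relation over the rationals can be tested at the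
   root [z] in [algC]. *)
rewrite -(eqp_map (ratr : {rmorphism rat -> algC})) gcdp_map => /eqp_root/(_ z).
rewrite root_gcd.
have prim_ab e : (e %| d)%N -> e.-primitive_root (z ^+ (d %/ e)).
  exact: dvdn_prim_root.
rewrite (root_Phi_set_comp L_pos (prim_ab a a_dv_d)) La.
rewrite (root_Phi_set_comp L_pos (prim_ab b b_dv_d)) Lb.
(* The gcd of the exponents is 1, and [z ^+ 1] still has order [d]. *)
by rewrite (@root_Phi_set_comp _ _ d) // expr1.
Qed.

Theorem theorem6 (L : {fset nat}) (L_pos : positive_set L)
    (L_nonempty : L != fset0) (L_sat : saturated L) :
  strong_divisibility (fun n : nat => Phi_set L \Po 'X^n) <->
  exists N : nat, (1 <= N)%N /\ L = divisor_set N.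
Proof.
split=> [sdL | [N [N_gt0 ->]] m n m_gt0 n_gt0]; last first.
  have PhiX k : Phi_set (divisor_set N) \Po 'X^k = 'X^(N * k) - 1.
    rewrite Phi_divisor_set // rmorphB rmorph1 /= rmorphXn /= comp_polyX.
    by rewrite -exprM mulnC.
  (* The exponents match because [N * gcd(m, n) = gcd(N * m, N * n)]. *)
  by rewrite !PhiX muln_gcdr gcdp_Xn_sub_1 // muln_gt0 N_gt0.
pose N := (\big[lcmn/1]_(d <- L) d)%N.
(* The iterated lcm starts from 1, so the induction placing [N] in [L] needs 1 in [L]; this is where
   nonemptiness enters. *)
have L1 : 1%N \in L.
  by have /fset0Pn[h] := L_nonempty; apply: L_sat; apply: dvd1n.
have LN : N \in L.
  rewrite /N big_seq; apply: (big_ind (fun d => d \in L)) => // a b.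
  exact: strong_divisibility_lcm.
have N_gt0 := L_pos _ LN.
exists N; split=> //; apply/fsetP => d; rewrite !inE -dvdn_divisors //.
apply/idP/idP => [Ld | d_dv_N]; last exact: L_sat d_dv_N LN.
by rewrite /N (big_rem d) //= dvdn_lcml.
Qed.
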